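(* $n(4,9) \leq 270$; that is, there exists a $4$-regular graph of girth exactly $9$ with at most $270$ vertices.
   Context: Graphs are finite and simple. For integers $k\ge 2$, $g\ge 3$, a $(k,g)$-graph is a $k$-regular graph with girth $g$ (the length of a shortest cycle is exactly $g$). $n(k,g)$ denotes the smallest possible number of vertices of a $(k,g)$-graph. *)

(* Defs.v *)
From HB Require Import structures.
From mathcomp Require Import all_boot.

Set Implicit Arguments.
Unset Strict Implicit.
Unset Printing Implicit Defensive.

Record sgraph := SGraph {
  vertex :> finType;
  adj : rel vertex;
  adj_sym : symmetric adj;
  adj_irrefl : irreflexive adj
}.

Definition regular (k : nat) (G : sgraph) : Prop :=
  forall x : G, #|[set y : G | adj x y]| = k.

(* [ucycleb] also accepts [::] and the closed walks [:: x; y] along a single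
   edge, which are not cycles of a simple graph; hence the bound on [size]. *)
Definition graph_cycle (G : sgraph) (c : seq G) : bool :=
  (2 < size c) && ucycleb (@adj G) c.

Definition has_girth (g : nat) (G : sgraph) : Prop :=
  (exists c : seq G, graph_cycle c /\ size c = g) /\
  (forall c : seq G, graph_cycle c -> g <= size c).

Definition kg_graph (k g : nat) (G : sgraph) : Prop :=
  regular k G /\ has_girth g G.

(* The graph of the partial function n(k,g): [is_n_kg k g m] says that n(k,g)
   exists and equals m.  A relation is used so that no default value has to be
   chosen for pairs (k,g) admitting no (k,g)-graph. *)
Definition is_n_kg (k g m : nat) : Prop :=
  (exists G : sgraph, kg_graph k g G /\ #|G| = m) /\
  (forall G : sgraph, kg_graph k g G -> m <= #|G|).

(* Main.v *)
(** The graph is a voltage lift with the abelian group Z_3 x Z_3 x Z_5 of a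
    4-regular multigraph on 6 vertices, K_{2,4} with a loop at each of the four
    vertices of degree 2.  The voltages come from a computer search among the
    lifts with groups of order 90: the graph is also a lift of a 3-vertex
    multigraph with the group Z_3 x Z_3 x D_5.  Since translations act by
    automorphisms, it suffices to check that the non-backtracking walks of
    length at most 8 from the 6 vertices (i, 0) never return to their origin. *)

Require Import Defs.
From HB Require Import structures.
From mathcomp Require Import all_boot.
From Stdlib Require Import Classical.
From mathcomp Require Import all_algebra.

Set Implicit Arguments.
Unset Strict Implicit.
Unset Printing Implicit Defensive.

Import GRing.Theory.

(** Descent on the number of vertices; whether a smaller graph exists is decided classically. *)
Lemma is_n_kg_exists k g (G : sgraph) :
  kg_graph k g G -> exists m, is_n_kg k g m /\ m <= #|G|.
Proof.
have [n] := ubnP #|G|; elim: n G => // n IHn G; rewrite ltnS => leGn kgG.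
have [[H [kgH ltHG]]|minG] :=
  classic (exists H : sgraph, kg_graph k g H /\ #|H| < #|G|).
  have [m [n_m lemH]] := IHn H (leq_trans ltHG leGn) kgH.
  by exists m; split=> //; apply: leq_trans lemH (ltnW ltHG).
exists #|G|; split=> //; split; first by exists G.
move=> H kgH; rewrite leqNgt; apply/negP => ltHG.
by apply: minG; exists H.
Qed.

Section NonBacktracking.
Variables (V : eqType) (nbr : V -> seq V).

(* No walk that arrives at [x] from [p] and takes at most [n.+1] further steps,
   none of them an immediate reversal, ever hits [o]. *)
Fixpoint avoids (n : nat) (o p x : V) : bool :=
  all (fun y => (y == p) ||
         (y != o) && (if n is n'.+1 then avoids n' o x y else true)) (nbr x).

(** A walk without repeated vertices never reverses a step, so the exemption [y == p] in [avoids]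
    does not apply, not even at the closing step, as [p != o]. *)
Lemma avoids_path n o p x s :
    p != o -> x != o -> uniq [:: p, x & s] -> o \notin s -> size s <= n ->
  avoids n o p x -> ~~ path (fun u v => v \in nbr u) x (rcons s o).
Proof.
elim: s n p x => [|y s IHs] n p x pNo xNo.
  move=> _ _ _ av; rewrite /= andbT; apply/negP => o_x.
  by case: n av => [|n] /= /allP /(_ o o_x); rewrite eqxx eq_sym (negPf pNo).
rewrite /= !inE !negb_or => /and4P[/and3P[_ pNy _] /andP[xNy xNs] yNs Us].
case/andP=> oNy oNs; case: n => // n; rewrite ltnS /= => les /allP av.
apply/negP => /andP[/av]; rewrite eq_sym (negPf pNy) /= => /andP[yNo avy].
by apply/negP/(IHs n x y) => //=; rewrite inE negb_or xNy xNs yNs.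
Qed.

(** After its first step a cycle needs [size c - 1] more to return, while [avoids n] excludes
    returns within [n + 1]. Taking [o] as predecessor exempts only the immediate return. *)
Lemma avoids_ucycle n c :
    (forall o, all (avoids n o o) (nbr o)) ->
  2 < size c -> ucycleb (fun u v => v \in nbr u) c -> n.+2 < size c.
Proof.
case: c => [|o [|x [|y s]]] // av _.
rewrite /ucycleb /= !inE !negb_or ltnNge.
case/andP=> /and3P[x_o y_x path_y].
case/andP=> /and3P[oNx oNy oNs] /and3P[/andP[xNy xNs] yNs Us].
rewrite !ltnS; apply/negP => les.
case: n av les => // n av les.
have /= avx := allP (av o) x x_o; have := allP avx y y_x.
rewrite eq_sym (negPf oNy) /= => avy.
apply: (negP (avoids_path _ _ _ oNs les avy)) => //; try by rewrite eq_sym.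
by rewrite /= inE negb_or xNy xNs yNs.
Qed.

Lemma avoids_map (f : V -> V) n o p x :
    injective f -> (forall z, nbr (f z) = [seq f y | y <- nbr z]) ->
  avoids n (f o) (f p) (f x) = avoids n o p x.
Proof.
move=> f_inj nbr_f; elim: n p x => [|n IHn] p x /=; rewrite nbr_f all_map;
  by apply: eq_all => y /=; rewrite !(inj_eq f_inj) ?IHn.
Qed.

End NonBacktracking.

Section VoltageGraph.
Variables (I : finType) (A : finZmodType) (edges : seq (I * I * A)).

(* A base edge [i -> j] of voltage [a] lifts to the edges
   [(i, u) -- (j, u + a)]. *)
Definition voltage_arcs (i : I) : seq (I * A) :=
  [seq (e.1.2, e.2) | e <- edges & e.1.1 == i] ++
  [seq (e.1.1, - e.2)%R | e <- edges & e.1.2 == i].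

Definition lift_nbr (x : I * A) : seq (I * A) :=
  [seq (d.1, x.2 + d.2)%R | d <- voltage_arcs x.1].

Definition lift_adj : rel (I * A) := [rel x y | y \in lift_nbr x].

Lemma voltage_arcsN i j a :
  ((j, a) \in voltage_arcs i) = ((i, - a)%R \in voltage_arcs j).
Proof.
(* Reversing an arc exchanges the two halves of [voltage_arcs]. *)
suff sub i' j' a' :
    (j', a') \in voltage_arcs i' -> (i', - a')%R \in voltage_arcs j'.
  by apply/idP/idP => /sub //; rewrite opprK.
rewrite !mem_cat => /orP[] /mapP[e]; rewrite mem_filter => /andP[/eqP ei e_in].
  case=> -> ->; apply/orP; right; apply/mapP; exists e; last by rewrite ei.
  by rewrite mem_filter eqxx.
case=> -> ->; apply/orP; left; apply/mapP; exists e; last by rewrite ei opprK.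
by rewrite mem_filter eqxx.
Qed.

Lemma mem_lift_nbr x y :
  (y \in lift_nbr x) = ((y.1, y.2 - x.2)%R \in voltage_arcs x.1).
Proof.
apply/mapP/idP => [[[j a] d_in ->]|d_in]; first by rewrite /= addrC addKr.
by exists (y.1, y.2 - x.2)%R; rewrite //= addrC subrK; case: y {d_in}.
Qed.

Lemma lift_adj_sym : symmetric lift_adj.
Proof.
by move=> x y; rewrite /lift_adj /= !mem_lift_nbr voltage_arcsN opprB.
Qed.

Lemma lift_adj_irrefl :
  (forall i, (i, 0)%R \notin voltage_arcs i) -> irreflexive lift_adj.
Proof.
by move=> no0 x; rewrite /lift_adj /= mem_lift_nbr subrr; apply/negbTE.
Qed.

Lemma lift_adj_card k x :
    uniq (voltage_arcs x.1) -> size (voltage_arcs x.1) = k ->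
  #|[set y | lift_adj x y]| = k.
Proof.
move=> Uarcs <-; rewrite cardsE -(size_map (fun d => (d.1, x.2 + d.2)%R)).
apply/card_uniqP; rewrite map_inj_uniq // => -[j a] [j' a'] /= [-> /addrI->] //.
Qed.

Definition lift_shift (u : A) (x : I * A) : I * A := (x.1, u + x.2)%R.

(** Translations add on the left and voltages on the right, so associativity suffices. *)
Lemma lift_nbr_shift u x :
  lift_nbr (lift_shift u x) = [seq lift_shift u y | y <- lift_nbr x].
Proof.
by rewrite -map_comp; apply: eq_map => d; rewrite /= /lift_shift addrA.
Qed.

Lemma lift_shift_inj u : injective (lift_shift u).
Proof. by case=> [i a] [j b] [-> /addrI->]. Qed.

Lemma lift_avoids n :
    (forall i, all (avoids lift_nbr n (i, 0)%R (i, 0)%R) (lift_nbr (i, 0)%R)) ->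
  forall o, all (avoids lift_nbr n o o) (lift_nbr o).
Proof.
move=> av [i u]; have -> : (i, u) = lift_shift u (i, 0)%R.
  by rewrite /lift_shift addr0.
rewrite lift_nbr_shift all_map; apply: sub_all (av i) => x /=.
by rewrite avoids_map //; [apply: lift_shift_inj | apply: lift_nbr_shift].
Qed.

End VoltageGraph.

Lemma forall_ord n (P : pred 'I_n.+1) :
  all (fun k => P (inZp k)) (iota 0 n.+1) -> forall i, P i.
Proof.
by move=> /allP allP i; rewrite -[i]valZpK; apply: allP; rewrite mem_iota /=.
Qed.

Definition shifts : Type := ('Z_3 * 'Z_3 * 'Z_5)%type.

HB.instance Definition _ := GRing.Zmodule.on shifts.
HB.instance Definition _ := Finite.on shifts.

Definition base_vertex (k : nat) : 'I_6 := inZp k.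

Definition lift_vertex (i a b c : nat) : 'I_6 * shifts :=
  (base_vertex i, (inZp a, inZp b, inZp c)).

Definition base_edge (i j a b c : nat) : 'I_6 * 'I_6 * shifts :=
  (base_vertex i, base_vertex j, (inZp a, inZp b, inZp c)).

(** The first eight entries form K_{2,4} with sides {0, 1} and {2, 3, 4, 5}; the last four are the
    loops, each adding 2 to the degree. *)
Definition edges270 : seq ('I_6 * 'I_6 * shifts) :=
  [:: base_edge 0 2 0 0 0; base_edge 0 3 0 0 0;
      base_edge 0 4 2 0 0; base_edge 0 5 0 1 1;
      base_edge 1 2 2 0 0; base_edge 1 3 0 1 4;
      base_edge 1 4 0 0 0; base_edge 1 5 0 0 0;
      base_edge 2 2 0 1 1; base_edge 3 3 1 0 4;
      base_edge 4 4 0 1 4; base_edge 5 5 1 0 1].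

Lemma edges270_no_zero_loop i : (i, 0)%R \notin voltage_arcs edges270 i.
Proof. by move: i; apply: forall_ord; vm_compute. Qed.

Lemma edges270_regular i :
  uniq (voltage_arcs edges270 i) && (size (voltage_arcs edges270 i) == 4).
Proof. by move: i; apply: forall_ord; vm_compute. Qed.

(** Depth 6 covers 1 + 7 = 8 steps, hence all cycles shorter than 9. *)
Lemma edges270_avoids i :
  all (avoids (lift_nbr edges270) 6 (i, 0)%R (i, 0)%R)
      (lift_nbr edges270 (i, 0)%R).
Proof. by move: i; apply: forall_ord; vm_compute. Qed.

Definition graph270 : sgraph :=
  SGraph (lift_adj_sym edges270) (lift_adj_irrefl edges270_no_zero_loop).

(** Lift of the closed base walk 0-2-1-3-0-2-1-4-4-0, whose voltages sum to zero; the loop at 4 is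
    traversed backwards. *)
Definition nine_cycle : seq graph270 :=
  [:: lift_vertex 0 0 0 0; lift_vertex 2 0 0 0; lift_vertex 1 1 0 0;
      lift_vertex 3 1 1 4; lift_vertex 0 1 1 4; lift_vertex 2 1 1 4;
      lift_vertex 1 2 1 4; lift_vertex 4 2 1 4; lift_vertex 4 2 0 0].

Lemma nine_cycleP : graph_cycle nine_cycle.
Proof. by vm_compute. Qed.

Lemma graph270_kg : kg_graph 4 9 graph270.
Proof.
split=> [x|].
  by case/andP: (edges270_regular x.1) => Uarcs /eqP; apply: lift_adj_card.
split; first by exists nine_cycle; split; first exact: nine_cycleP.
by move=> c /andP[]; apply/avoids_ucycle/lift_avoids/edges270_avoids.
Qed.

Lemma card_graph270 : #|graph270| = 270.
Proof. by rewrite !card_prod !card_ord. Qed.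

Theorem mainTheorem3 :
  (exists m : nat, is_n_kg 4 9 m /\ m <= 270) /\
  (exists G : sgraph, kg_graph 4 9 G /\ #|G| <= 270).
Proof.
rewrite -card_graph270; split; first exact: is_n_kg_exists graph270_kg.
by exists graph270; split; first exact: graph270_kg.
Qed.
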